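(* Let $G$ and $H$ be finite simple graphs with nonempty, disjoint vertex sets, and suppose that $\widetilde{D}_G x=\mathbbm{1}$ has no solution. Let $D$ be the distance matrix of the graph join $G+H$. Then $Dx=\mathbbm{1}$ has no solution if and only if there exists a solution $x$ to $\widetilde{D}_H x=\mathbbm{1}$ such that $\langle x,\mathbbm{1}\rangle=0$.
   Context: For a graph $G$ on $n$ vertices with adjacency matrix $A_G$, define $\widetilde{D}_G=2J-2I-A_G$, where $J$ is the $n\times n$ all-ones matrix and $I$ is the $n\times n$ identity matrix. The graph join $G+H$ is the graph on vertex set $V(G)\cup V(H)$ whose edges are all edges of $G$, all edges of $H$, and all edges joining a vertex of $G$ to a vertex of $H$. The distance matrix of a connected graph with vertices $v_1,\dots,v_n$ has entries $D_{ij}=d(v_i,v_j)$ (shortest-path distance). $\mathbbm{1}$ denotes the all-ones column vector of the appropriate length, $\langle\cdot,\cdot\rangle$ is the standard inner product, and solutions are real vectors. *)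

(* Defs.v *)
From HB Require Import structures.
From mathcomp Require Import all_boot all_order all_algebra.
From mathcomp Require Import reals.

Set Implicit Arguments.
Unset Strict Implicit.
Unset Printing Implicit Defensive.

Import GRing.Theory.
Local Open Scope ring_scope.

Record sgraph := SGraph {
  vertex :> finType;
  adj : rel vertex;
  adj_sym : symmetric adj;
  adj_irr : irreflexive adj
}.

Section Join.
Variables G H : sgraph.

Definition join_adj : rel (vertex G + vertex H) := fun u v =>
  match u, v with
  | inl x, inl y => adj x y
  | inr x, inr y => adj x y
  | _, _ => true
  end.

Lemma join_adj_sym : symmetric join_adj.
Proof. by move=> [x|x] [y|y] //=; rewrite adj_sym. Qed.

Lemma join_adj_irr : irreflexive join_adj.
Proof. by move=> [x|x] /=; rewrite adj_irr. Qed.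

(* The sum type makes the two vertex sets disjoint. *)
Definition join : sgraph := SGraph join_adj_sym join_adj_irr.

End Join.

Section Distance.
Variable G : sgraph.

Definition walk (k : nat) (x y : G) : bool :=
  [exists p : k.-tuple G, path (@adj G) x p && (last x p == y)].

(* Length of a shortest walk from x to y; such a walk repeats no vertex, so
   searching the lengths below #|G| suffices. The value is #|G| when x and y
   are not connected. *)
Definition gdist (x y : G) : nat :=
  find (fun k => walk k x y) (iota 0 #|G|).

Definition connected_graph : Prop := forall x y : G, connect (@adj G) x y.

Lemma gdist_walk (x y : G) :
  connect (@adj G) x y -> walk (gdist x y) x y.
Proof.
case/connectP=> p0 /shortenP[p pth uniq_p _] ->.
have szp : (size p < #|G|)%N.
  by have := max_card [in x :: p]; rewrite (card_uniqP uniq_p).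
have hasw : has (fun k => walk k x (last x p)) (iota 0 #|G|).
  apply/hasP; exists (size p); first by rewrite mem_iota.
  by apply/existsP; exists (in_tuple p); rewrite pth eqxx.
have := nth_find 0%N hasw; rewrite nth_iota ?add0n //.
by move: hasw; rewrite has_find size_iota.
Qed.

Lemma gdist_min (x y : G) (k : nat) : walk k x y -> (gdist x y <= k)%N.
Proof.
move=> wk; rewrite leqNgt; apply/negP => lt_k.
have := before_find 0%N lt_k; rewrite nth_iota ?add0n ?wk //.
by apply: leq_trans lt_k _; rewrite /gdist -[leqRHS](size_iota 0) find_size.
Qed.

End Distance.

Lemma join_connected (G H : sgraph) :
  (0 < #|G|)%N -> (0 < #|H|)%N -> connected_graph (join G H).
Proof.
move=> /card_gt0P[g _] /card_gt0P[h _] [x|x] [y|y].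
- by apply: (@connect_trans _ _ (inr h)); apply: connect1.
- exact: connect1.
- exact: connect1.
- by apply: (@connect_trans _ _ (inl g)); apply: connect1.
Qed.

(* Matrices and vectors are indexed through the enumeration enum_val of the
   vertices; none of the properties considered depends on its order. *)
Section Matrices.
Variables (R : realType) (G : sgraph).

Definition adj_mx : 'M[R]_#|G| :=
  \matrix_(i, j) (adj (enum_val i) (enum_val j))%:R.

Definition dist_mx : 'M[R]_#|G| :=
  \matrix_(i, j) (gdist (enum_val i) (enum_val j))%:R.

Definition Dtilde : 'M[R]_#|G| := 2 *: const_mx 1 - 2 *: 1%:M - adj_mx.

End Matrices.

Definition ones (R : realType) (n : nat) : 'cV[R]_n := const_mx 1.

Definition dotv (R : realType) (n : nat) (u v : 'cV[R]_n) : R :=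
  \sum_i u i 0 * v i 0.

(* Main.v *)
Require Import Defs.
From mathcomp Require Import all_boot all_order all_algebra.
From mathcomp Require Import reals.

(** In a join, two distinct vertices on the same side are at distance 1 or 2,
    and vertices on opposite sides are at distance 1. Hence the distance matrix
    of [join G H] is the block matrix with diagonal blocks [Dtilde G] and
    [Dtilde H] and all-ones off-diagonal blocks ([mul_dist_mx_join]), and the
    system for a vector with parts [y], [z] reads
      [Dtilde G *m y = (1 - <z,1>) 1]  and  [Dtilde H *m z = (1 - <y,1>) 1].
    Since [Dtilde G *m y = 1] is unsolvable, the first equation forces
    [<z,1> = 1] and [Dtilde G *m y = 0]. By the Fredholm alternative for the
    symmetric matrix [Dtilde G] ([sym_mx_fredholm]), its kernel contains vectors
    of any prescribed coordinate sum. So the system is solvable iff some [z]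
    with [<z,1> = 1] is mapped by [Dtilde H] to a multiple of the all-ones
    vector ([dist_mx_join_solvable]).

    If [Dtilde H *m x = 1] with [<x,1> = 0], such a [z] cannot exist, because
    [1 = <1,z> = <Dtilde H x, z> = <x, Dtilde H z>] would be a multiple of
    [<x,1> = 0]. Conversely, if no such [z] exists, every kernel vector of
    [Dtilde H] has coordinate sum 0, so the Fredholm alternative provides a
    solution of [Dtilde H *m x = 1], and its sum is 0 since it could otherwise be
    rescaled into such a [z]. *)

Set Implicit Arguments.
Unset Strict Implicit.
Unset Printing Implicit Defensive.

Import GRing.Theory.
Local Open Scope ring_scope.

(** Over a field, the columns of the cokernel of [A] test membership in the row
    space of [A]; symmetry turns this into solvability of [A *m x = b]. *)
Lemma sym_mx_fredholm (F : fieldType) (n : nat) (A : 'M[F]_n) (b : 'cV[F]_n) :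
  A^T = A ->
  (exists x : 'cV[F]_n, A *m x = b) \/
  (exists z : 'cV[F]_n, A *m z = 0 /\ \sum_i z i 0 * b i 0 != 0).
Proof.
move=> symA.
have [/submxP[x bE]|] := boolP (b^T <= A)%MS.
  by left; exists x^T; rewrite -[b]trmxK bE trmx_mul symA.
rewrite submxE => /matrix0Pn[i [j]]; rewrite ord1 mxE => nz.
right; exists (col j (cokermx A)); split; first by rewrite colE mulmxA mulmx_coker mul0mx.
congr (_ != 0): nz.
by apply: eq_bigr => k _; rewrite !mxE mulrC.
Qed.

Section Distance.
Variable G : sgraph.
Implicit Types x y z : G.

Lemma walk0 x y : walk 0 x y = (x == y).
Proof.
apply/existsP/idP => [[p]|/eqP->]; first by rewrite (tuple0 p).
by exists [tuple]; rewrite /= eqxx.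
Qed.

Lemma walk1 x y : walk 1 x y = adj x y.
Proof.
apply/existsP/idP => [[p]|xy].
  by case/tupleP: p => z p; rewrite (tuple0 p) /= andbT => /andP[xz /eqP<-].
by exists [tuple y]; rewrite /= xy eqxx.
Qed.

Lemma gdist_refl x : gdist x x = 0%N.
Proof. by apply/eqP; rewrite -leqn0 gdist_min // walk0. Qed.

Lemma gdist_adj x y : adj x y -> gdist x y = 1%N.
Proof.
move=> xy; have := gdist_walk (connect1 xy).
have := @gdist_min _ x y 1; rewrite walk1 => /(_ xy).
case: (gdist x y) => [|[|k]] // _; rewrite walk0 => /eqP E.
by rewrite E adj_irr in xy.
Qed.

(** With a common neighbour the distance is at most 2, so it is determined by
    equality and adjacency. *)
Lemma gdist_common_neighbor (R : pzRingType) x y z :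
  adj x z -> adj z y ->
  (gdist x y)%:R = 2 - 2 * (x == y)%:R - (adj x y)%:R :> R.
Proof.
move=> xz zy; case: eqVneq => [->|neq].
  by rewrite gdist_refl adj_irr mulr1 subrr subr0.
case: (boolP (adj x y)) => xy; first by rewrite gdist_adj // mulr0 subr0 addrK.
have le2 : (gdist x y <= 2)%N.
  by apply: gdist_min; apply/existsP; exists [tuple z; y]; rewrite /= xz zy eqxx.
have := gdist_walk (connect_trans (connect1 xz) (connect1 zy)).
case: (gdist x y) le2 => [|[|[|//]]] _ w; last by rewrite mulr0 !subr0.
- by rewrite walk0 (negPf neq) in w.
- by rewrite walk1 (negPf xy) in w.
Qed.

End Distance.

Section Vectors.
Variable R : realType.

Lemma dotvZl n c (x y : 'cV[R]_n) : dotv (c *: x) y = c * dotv x y.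
Proof. by rewrite /dotv mulr_sumr; apply: eq_bigr => i _; rewrite mxE mulrA. Qed.

Lemma dotvZr n c (x y : 'cV[R]_n) : dotv x (c *: y) = c * dotv x y.
Proof.
by rewrite /dotv mulr_sumr; apply: eq_bigr => i _; rewrite mxE mulrCA.
Qed.

Lemma dotvC n (x y : 'cV[R]_n) : dotv x y = dotv y x.
Proof. by apply: eq_bigr => i _; rewrite mulrC. Qed.

Lemma dotvE n (x y : 'cV[R]_n) : dotv x y = (x^T *m y) 0 0.
Proof. by rewrite mxE; apply: eq_bigr => i _; rewrite mxE. Qed.

Lemma dotv_sym_mx n (A : 'M[R]_n) x y :
  A^T = A -> dotv (A *m x) y = dotv x (A *m y).
Proof. by move=> symA; rewrite !dotvE trmx_mul symA mulmxA. Qed.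

Lemma Dtilde_sym (G : sgraph) : (Dtilde R G)^T = Dtilde R G.
Proof. by apply/matrixP => i j; rewrite !mxE adj_sym eq_sym. Qed.

Lemma DtildeE (G : sgraph) i j :
  Dtilde R G i j = 2 - 2 * (enum_val i == enum_val j)%:R
                   - (adj (enum_val i) (enum_val j))%:R.
Proof. by rewrite !mxE (inj_eq enum_val_inj) mulr1. Qed.

End Vectors.

Section JoinVectors.
Variables (R : realType) (G H : sgraph).
Implicit Types (y : 'cV[R]_#|G|) (z : 'cV[R]_#|H|).

(** The enumeration of the vertices of the join is not the concatenation of the
    two enumerations, so the two parts are glued vertex by vertex. *)
Definition join_vec y z : 'cV[R]_#|join G H| :=
  \col_i match (enum_val i : G + H) with
         | inl u => y (enum_rank u) 0
         | inr v => z (enum_rank v) 0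
         end.

Lemma join_vec_surj (x : 'cV[R]_#|join G H|) : exists y z, x = join_vec y z.
Proof.
exists (\col_i x (@enum_rank (join G H) (inl (enum_val i))) 0).
exists (\col_i x (@enum_rank (join G H) (inr (enum_val i))) 0).
apply/colP => i; rewrite mxE.
by case E: (enum_val i) => [u|v]; rewrite mxE enum_rankK -E enum_valK.
Qed.

Lemma join_vec_inj y y' z z' :
  join_vec y z = join_vec y' z' -> y = y' /\ z = z'.
Proof.
move=> /colP E; split; apply/colP => i.
- have := E (@enum_rank (join G H) (inl (enum_val i))).
  by rewrite !mxE enum_rankK enum_valK.
- have := E (@enum_rank (join G H) (inr (enum_val i))).
  by rewrite !mxE enum_rankK enum_valK.
Qed.

Lemma join_vec_ones : join_vec (ones R _) (ones R _) = ones R _.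
Proof. by apply/colP => i; rewrite !mxE; case: (enum_val i) => ?; rewrite mxE. Qed.

Lemma dist_mx_join_row y z (i : 'I_#|join G H|) :
  (dist_mx R (join G H) *m join_vec y z) i 0 =
    \sum_(j < #|G|) (@gdist (join G H) (enum_val i) (inl (enum_val j)))%:R * y j 0
  + \sum_(j < #|H|) (@gdist (join G H) (enum_val i) (inr (enum_val j)))%:R * z j 0.
Proof.
pose f (w : G + H) : R := (@gdist (join G H) (enum_val i) w)%:R *
  match w with inl u => y (enum_rank u) 0 | inr v => z (enum_rank v) 0 end.
rewrite mxE (eq_bigr (fun k => f (enum_val k))); last by move=> k _; rewrite !mxE.
rewrite -(big_enum_val f) /= big_sumType /=.
by congr (_ + _); rewrite big_enum_val; apply: eq_bigr => k _; rewrite /f enum_valK.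
Qed.

Hypotheses (G_nonempty : (0 < #|G|)%N) (H_nonempty : (0 < #|H|)%N).

(** Any vertex of the other side is a common neighbour of two vertices of the
    same side; this is where both sides have to be nonempty. *)
Lemma mul_dist_mx_join y z :
  dist_mx R (join G H) *m join_vec y z =
  join_vec (Dtilde R G *m y + dotv z (ones R _) *: ones R _)
           (Dtilde R H *m z + dotv y (ones R _) *: ones R _).
Proof.
have /card_gt0P[g _] := G_nonempty; have /card_gt0P[h _] := H_nonempty.
apply/colP => i; rewrite dist_mx_join_row mxE.
case: (enum_val i) => [u|v].
- rewrite mxE [X in _ = X + _]mxE [X in _ = _ + X]mxE mxE mulr1.
  congr (_ + _); apply: eq_bigr => j _.
    by rewrite (@gdist_common_neighbor (join G H) _ _ _ (inr h)) // DtildeE enum_rankK.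
  by rewrite gdist_adj // mxE mulrC.
- rewrite addrC mxE [X in _ = X + _]mxE [X in _ = _ + X]mxE mxE mulr1.
  congr (_ + _); apply: eq_bigr => j _.
    by rewrite (@gdist_common_neighbor (join G H) _ _ _ (inl g)) // DtildeE enum_rankK.
  by rewrite gdist_adj // mxE mulrC.
Qed.

Lemma dist_mx_join_solvable :
  ~ (exists y, Dtilde R G *m y = ones R _) ->
  (exists x, dist_mx R (join G H) *m x = ones R _) <->
  (exists z c, Dtilde R H *m z = c *: ones R _ /\ dotv z (ones R _) = 1).
Proof.
move=> nosol; split=> [[x]|[z [c [Dz z1]]]].
  have [y [z ->]] := join_vec_surj x.
  rewrite mul_dist_mx_join -join_vec_ones => /join_vec_inj[Ey Ez].
  exists z, (1 - dotv y (ones R _)); split.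
    by rewrite scalerBl scale1r -[X in X - _]Ez addrK.
  have [/eqP|nz] := eqVneq (1 - dotv z (ones R _)) 0.
    by rewrite subr_eq0 => /eqP.
  case: nosol; exists ((1 - dotv z (ones R _))^-1 *: y).
  have Dy : Dtilde R G *m y = (1 - dotv z (ones R _)) *: ones R _.
    by rewrite scalerBl scale1r -[X in X - _]Ey addrK.
  by rewrite -scalemxAr Dy scalerA mulVf // scale1r.
have [//|[k [Dk nz]]] := sym_mx_fredholm (ones R _) (Dtilde_sym R G).
(* The kernel vector is scaled to sum [1 - c], which makes the right-hand side
   of the second block equation equal to [c]. *)
exists (join_vec (((1 - c) / dotv k (ones R _)) *: k) z).
rewrite mul_dist_mx_join -scalemxAr Dk scaler0 add0r z1 scale1r Dz dotvZl.
by rewrite divfK // -scalerDl addrC subrK scale1r join_vec_ones.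
Qed.

End JoinVectors.

Theorem theorem4 (R : realType) (G H : sgraph)
  (G_nonempty : (0 < #|G|)%N) (H_nonempty : (0 < #|H|)%N)
  (G_nosol : ~ exists x : 'cV[R]_#|G|, Dtilde R G *m x = ones R #|G|) :
  (~ exists x : 'cV[R]_#|join G H|,
       dist_mx R (join G H) *m x = ones R #|join G H|)
  <->
  (exists x : 'cV[R]_#|H|,
     Dtilde R H *m x = ones R #|H| /\ dotv x (ones R #|H|) = 0).
Proof.
rewrite (dist_mx_join_solvable G_nonempty H_nonempty G_nosol).
split=> [noz|[x [Dx x0]] [z [c [Dz z1]]]]; last first.
  have /eqP := dotv_sym_mx x z (Dtilde_sym R H).
  by rewrite Dx Dz dotvZr x0 mulr0 dotvC z1 oner_eq0.
have sum0 z c : Dtilde R H *m z = c *: ones R _ -> dotv z (ones R _) = 0.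
  move=> Dz; apply/eqP/negPn/negP => nz; apply: noz.
  exists ((dotv z (ones R _))^-1 *: z), ((dotv z (ones R _))^-1 * c).
  by rewrite -scalemxAr Dz scalerA dotvZl mulVf.
have [[x Dx]|[k [Dk /eqP[]]]] := sym_mx_fredholm (ones R _) (Dtilde_sym R H).
  by exists x; split=> //; apply: (sum0 _ 1); rewrite scale1r.
by apply: (sum0 _ 0); rewrite Dk scale0r.
Qed.
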